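(* $\mathsf{DT}^2_{4,2}$ implies $\mathsf{ER}^2$.
   Context: Implications are in the sense of reverse mathematics over $\mathsf{RCA}_0$. $\mathsf{DT}^2_{4,2}$: for every $f:[\mathbb Q]^2\to4$ there is $S\subseteq\mathbb Q$ such that $(S,<)$ is a dense linear order without endpoints and $|f([S]^2)|\le2$. $\mathsf{ER}^2$ (Erdős–Rado theorem): for every $f:[\mathbb Q]^2\to2$ there exists $S\subseteq\mathbb Q$ such that either $S$ is infinite and $f$ is constantly $0$ on $[S]^2$, or $(S,<)$ has order type $\mathbb Q$ and $f$ is constantly $1$ on $[S]^2$. *)

(* Defs.v *)
(* Reverse mathematics over RCA_0, formalized semantically:
   "RCA_0 proves P -> Q" is rendered (via the completeness theorem for
   second-order arithmetic with Henkin semantics) as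
   "every L_2-structure satisfying the axioms of RCA_0 and P satisfies Q". *)
From Stdlib Require Import Arith.

Record L2 : Type := {
  num : Type;
  sset : Type;
  zro : num;
  one : num;
  add : num -> num -> num;
  mul : num -> num -> num;
  lt  : num -> num -> Prop;
  mem : num -> sset -> Prop
}.
Arguments zro {_}. Arguments one {_}. Arguments add {_} _ _.
Arguments mul {_} _ _. Arguments lt {_} _ _. Arguments mem {_} _ _.

Inductive term : Type :=
| TVar (i : nat) | TZero | TOne | TAdd (t u : term) | TMul (t u : term).

Inductive formula : Type :=
| FEq (t u : term) | FLt (t u : term) | FMem (t : term) (X : nat)
| FNot (A : formula) | FAnd (A B : formula) | FOr (A B : formula)
| FImp (A B : formula)
| FAllB (i : nat) (t : term) (A : formula)
| FExB (i : nat) (t : term) (A : formula)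
| FAll (i : nat) (A : formula) | FEx (i : nat) (A : formula)
| FAllS (X : nat) (A : formula) | FExS (X : nat) (A : formula).

Definition upd {A : Type} (e : nat -> A) (i : nat) (a : A) : nat -> A :=
  fun j => if Nat.eqb j i then a else e j.

Fixpoint eval (M : L2) (e : nat -> num M) (t : term) : num M :=
  match t with
  | TVar i => e i
  | TZero => zro
  | TOne => one
  | TAdd t u => add (eval M e t) (eval M e u)
  | TMul t u => mul (eval M e t) (eval M e u)
  end.

Fixpoint sat (M : L2) (e : nat -> num M) (E : nat -> sset M) (A : formula) : Prop :=
  match A with
  | FEq t u => eval M e t = eval M e u
  | FLt t u => lt (eval M e t) (eval M e u)
  | FMem t X => mem (eval M e t) (E X)
  | FNot A => ~ sat M e E A
  | FAnd A B => sat M e E A /\ sat M e E B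
  | FOr A B => sat M e E A \/ sat M e E B
  | FImp A B => sat M e E A -> sat M e E B
  | FAllB i t A => forall a, lt a (eval M e t) -> sat M (upd e i a) E A
  | FExB i t A => exists a, lt a (eval M e t) /\ sat M (upd e i a) E A
  | FAll i A => forall a, sat M (upd e i a) E A
  | FEx i A => exists a, sat M (upd e i a) E A
  | FAllS X A => forall S, sat M e (upd E X S) A
  | FExS X A => exists S, sat M e (upd E X S) A
  end.

Fixpoint bounded (A : formula) : bool :=
  match A with
  | FEq _ _ | FLt _ _ | FMem _ _ => true
  | FNot A => bounded A
  | FAnd A B | FOr A B | FImp A B => bounded A && bounded B
  | FAllB _ _ A | FExB _ _ A => bounded A
  | _ => false
  end.

Definition Sigma01 (A : formula) : Prop :=
  exists i B, A = FEx i B /\ bounded B = true.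
Definition Pi01 (A : formula) : Prop :=
  exists i B, A = FAll i B /\ bounded B = true.

Definition BasicAxioms (M : L2) : Prop :=
  (forall n : num M, add n one <> zro) /\
  (forall m n : num M, add m one = add n one -> m = n) /\
  (forall m : num M, add m zro = m) /\
  (forall m n : num M, add m (add n one) = add (add m n) one) /\
  (forall m : num M, mul m zro = zro) /\
  (forall m n : num M, mul m (add n one) = add (mul m n) m) /\
  (forall m : num M, ~ lt m zro) /\
  (forall m n : num M, lt m (add n one) <-> (lt m n \/ m = n)).

Definition Sigma01Induction (M : L2) : Prop :=
  forall (A : formula) (i : nat), Sigma01 A ->
  forall (e : nat -> num M) (E : nat -> sset M),
    sat M (upd e i zro) E A ->
    (forall a, sat M (upd e i a) E A -> sat M (upd e i (add a one)) E A) ->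
    forall a, sat M (upd e i a) E A.

Definition Delta01Comprehension (M : L2) : Prop :=
  forall (A B : formula) (i : nat), Sigma01 A -> Pi01 B ->
  forall (e : nat -> num M) (E : nat -> sset M),
    (forall a, sat M (upd e i a) E A <-> sat M (upd e i a) E B) ->
    exists X : sset M, forall a, mem a X <-> sat M (upd e i a) E A.

Definition RCA0 (M : L2) : Prop :=
  BasicAxioms M /\ Sigma01Induction M /\ Delta01Comprehension M.

Section Coding.
Variable M : L2.

Definition two : num M := add one one.
Definition four : num M := add two two.

(* Cantor pairing, as a relation: (m+n)(m+n+1) + 2m = 2k *)
Definition PairR (m n k : num M) : Prop :=
  add (mul (add m n) (add (add m n) one)) (add m m) = add k k.

Definition Code3 (p q i x : num M) : Prop :=
  exists u, PairR p q u /\ PairR u i x.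

(* A number k = <<a,c>,b> codes the rational (a - c)/(b + 1). *)
Definition qlt (k k' : num M) : Prop :=
  exists a c b a' c' b', Code3 a c b k /\ Code3 a' c' b' k' /\
    lt (add (mul a (add b' one)) (mul c' (add b one)))
       (add (mul a' (add b one)) (mul c (add b' one))).
Definition qeqv (k k' : num M) : Prop :=
  exists a c b a' c' b', Code3 a c b k /\ Code3 a' c' b' k' /\
    add (mul a (add b' one)) (mul c' (add b one)) =
    add (mul a' (add b one)) (mul c (add b' one)).

(* The rationals Q: the least code of each rational value; ordered by qlt. *)
Definition IsQ (k : num M) : Prop :=
  (exists a c b, Code3 a c b k) /\ (forall k', lt k' k -> ~ qeqv k' k).

(* f(p,q) = i, where the set F codes f : [Q]^2 -> k via triples <<p,q>,i>,
   a 2-element subset {p,q} being represented by p <_Q q. *)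
Definition Col (F : sset M) (p q i : num M) : Prop :=
  exists x, Code3 p q i x /\ mem x F.

Definition IsColoring (k : num M) (F : sset M) : Prop :=
  (forall x, mem x F -> exists p q i,
      Code3 p q i x /\ IsQ p /\ IsQ q /\ qlt p q /\ lt i k) /\
  (forall p q, IsQ p -> IsQ q -> qlt p q -> exists i, Col F p q i) /\
  (forall p q i j, Col F p q i -> Col F p q j -> i = j).

Definition SubQ (S : sset M) : Prop := forall x, mem x S -> IsQ x.

Definition DLOwoEnd (S : sset M) : Prop :=
  SubQ S /\ (exists x, mem x S) /\
  (forall p q, mem p S -> mem q S -> qlt p q ->
     exists r, mem r S /\ qlt p r /\ qlt r q) /\
  (forall p, mem p S -> exists q r, mem q S /\ mem r S /\ qlt q p /\ qlt p r).

(* S is finite iff it is bounded (Simpson); infinite = not finite *)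
Definition Infinite (S : sset M) : Prop :=
  ~ exists k, forall n, mem n S -> lt n k.

(* (S,<_Q) has order type Q: there is (a set coding) an order isomorphism
   h : Q -> S, coded by pairs <q, h(q)>. *)
Definition HRel (H : sset M) (q s : num M) : Prop :=
  exists x, PairR q s x /\ mem x H.

Definition OrderTypeQ (S : sset M) : Prop :=
  SubQ S /\ exists H : sset M,
    (forall x, mem x H -> exists q s, PairR q s x /\ IsQ q /\ mem s S) /\
    (forall q, IsQ q -> exists s, HRel H q s) /\
    (forall q s s', HRel H q s -> HRel H q s' -> s = s') /\
    (forall s, mem s S -> exists q, IsQ q /\ HRel H q s) /\
    (forall q q' s s', HRel H q s -> HRel H q' s' -> qlt q q' -> qlt s s').

Definition DT2_4_2 : Prop :=
  forall F : sset M, IsColoring four F ->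
  exists S : sset M, DLOwoEnd S /\
    exists c1 c2, forall p q i, mem p S -> mem q S -> qlt p q ->
      Col F p q i -> i = c1 \/ i = c2.

Definition ER2 : Prop :=
  forall F : sset M, IsColoring two F ->
  exists S : sset M, SubQ S /\
    ((Infinite S /\ forall p q i, mem p S -> mem q S -> qlt p q ->
        Col F p q i -> i = zro) \/
     (OrderTypeQ S /\ forall p q i, mem p S -> mem q S -> qlt p q ->
        Col F p q i -> i = one)).

End Coding.

(* Main.v *)
(* Multiply the given colouring of pairs of rationals by Sierpinski's colouring, which tells
   whether the rational order of a pair agrees with the order of its codes.  On a dense set [S]
   where the resulting 4-colouring takes two values, either all agreeing pairs have colour 0, or
   all disagreeing pairs do, or colour 0 is not taken at all.  In the first two cases the
   elements of [S] that are above (below) all elements of [S] with a smaller code form an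
   infinite set of colour 0.  In the third case [Q] is embedded into [S] by recursion on codes,
   each [q] going to the least code [t >= q] in [S] that is consistent with the earlier values;
   since the values dominate their arguments, the range is again a set.  Inside a model of RCA_0
   the recursion is carried out with finite sets coded by divisibility, as for Goedel's beta
   function. *)
From Stdlib Require Import Arith Lia List Classical Ring.
Require Import Defs.
Import ListNotations.

Declare Scope num_scope.
Delimit Scope num_scope with num.
Notation "0" := zro : num_scope.
Notation "1" := one : num_scope.
Notation "x + y" := (add x y) : num_scope.
Notation "x * y" := (mul x y) : num_scope.
Notation "x < y" := (lt x y) : num_scope.
(* In this form a quantifier bounded by [<=] is an instance of [FExB] or [FAllB]. *)
Notation "x <= y" := (lt x (add y one)) : num_scope.
Local Open Scope num_scope.

(** * Bounded definability *)

Section Definability.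
Context {M : L2}.

Definition prefix_of {A} (s : list A) (e : nat -> A) : Prop :=
  forall i a, nth_error s i = Some a -> e i = a.

Lemma prefix_of_nth {A} (s : list A) (d : A) : prefix_of s (fun i => nth i s d).
Proof. intros i a H. now apply nth_error_nth. Qed.

Lemma prefix_of_app_l {A} (s s' : list A) e : prefix_of (s ++ s') e -> prefix_of s e.
Proof.
  intros H i a Hi. apply H. rewrite nth_error_app1; [exact Hi|].
  apply nth_error_Some. congruence.
Qed.

Lemma prefix_of_snoc {A} (s : list A) e a :
  prefix_of s e -> prefix_of (s ++ [a]) (upd e (length s) a).
Proof.
  intros H i b Hi. unfold upd. destruct (Nat.eqb_spec i (length s)) as [->|N].
  - rewrite nth_error_app2, Nat.sub_diag in Hi by auto. now injection Hi.
  - apply H. rewrite nth_error_app1 in Hi; [exact Hi|].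
    assert (K : (i < length (s ++ [a]))%nat) by (apply nth_error_Some; congruence).
    rewrite length_app in K; simpl in K. lia.
Qed.

(* [vs] lists the variables, as functions of an assignment of type [Env]; parameters from [M]
   are constant functions, and [Xs] lists the set parameters. *)
Definition definable_term {Env} (vs : list (Env -> num M)) (T : Env -> num M) : Prop :=
  exists t, forall g e, prefix_of (map (fun v => v g) vs) e -> eval M e t = T g.

Definition Delta0 {Env} (Xs : list (sset M)) (vs : list (Env -> num M)) (P : Env -> Prop) :=
  exists A, bounded A = true /\ forall g e E,
    prefix_of (map (fun v => v g) vs) e -> prefix_of Xs E -> (sat M e E A <-> P g).

Definition params (l : list (num M)) : list (unit -> num M) := map (fun c _ => c) l.

Definition bind {Env} (vs : list (Env -> num M)) : list (Env * num M -> num M) :=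
  map (fun v p => v (fst p)) vs ++ [snd].

Lemma prefix_of_params (l : list (num M)) d :
  prefix_of (map (fun v => v tt) (params l)) (fun i => nth i l d).
Proof. unfold params. rewrite map_map, map_id. apply prefix_of_nth. Qed.

Lemma map_bind {Env} (vs : list (Env -> num M)) g a :
  map (fun v => v (g, a)) (bind vs) = map (fun v => v g) vs ++ [a].
Proof. unfold bind. now rewrite map_app, map_map. Qed.

Lemma length_bind {Env} (vs : list (Env -> num M)) : length (bind vs) = S (length vs).
Proof. unfold bind. rewrite length_app, length_map. simpl. lia. Qed.

Lemma prefix_of_bind {Env} (vs : list (Env -> num M)) g a e :
  prefix_of (map (fun v => v g) vs) e ->
  prefix_of (map (fun v => v (g, a)) (bind vs)) (upd e (length vs) a).
Proof.
  intros H. rewrite map_bind, <- (length_map (fun v => v g) vs). now apply prefix_of_snoc.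
Qed.

Lemma term_param (l : list (num M)) c : In c l -> definable_term (params l) (fun _ => c).
Proof.
  intros H. apply In_nth_error in H as [i Hi]. exists (TVar i). intros [] e He. apply He.
  unfold params. now rewrite map_map, map_id.
Qed.

Section Closure.
Context {Env : Type} (Xs : list (sset M)) (vs : list (Env -> num M)).
Implicit Types (T U : Env -> num M) (P Q : Env -> Prop).

Lemma term_fst T : definable_term vs T -> definable_term (bind vs) (fun p => T (fst p)).
Proof.
  intros [t Ht]. exists t. intros [g a] e He. apply Ht.
  rewrite map_bind in He. now apply prefix_of_app_l in He.
Qed.

Lemma term_snd : definable_term (bind vs) snd.
Proof.
  exists (TVar (length vs)). intros [g a] e He. apply He.
  now rewrite map_bind, nth_error_app2, length_map, Nat.sub_diag by now rewrite length_map.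
Qed.

Lemma term_zero : definable_term vs (fun _ => 0).
Proof. now exists TZero. Qed.

Lemma term_one : definable_term vs (fun _ => 1).
Proof. now exists TOne. Qed.

Lemma term_add T U :
  definable_term vs T -> definable_term vs U -> definable_term vs (fun g => T g + U g).
Proof.
  intros [t Ht] [u Hu]. exists (TAdd t u). intros g e He; simpl.
  now rewrite (Ht g), (Hu g).
Qed.

Lemma term_mul T U :
  definable_term vs T -> definable_term vs U -> definable_term vs (fun g => T g * U g).
Proof.
  intros [t Ht] [u Hu]. exists (TMul t u). intros g e He; simpl.
  now rewrite (Ht g), (Hu g).
Qed.

Lemma delta0_ext P Q : (forall g, P g <-> Q g) -> Delta0 Xs vs Q -> Delta0 Xs vs P.
Proof.
  intros PQ [A [HA HQ]]. exists A. split; [exact HA|]. intros g e E He HE.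
  now rewrite (HQ g), PQ.
Qed.

Lemma delta0_fst P : Delta0 Xs vs P -> Delta0 Xs (bind vs) (fun p => P (fst p)).
Proof.
  intros [A [HA HP]]. exists A. split; [exact HA|]. intros [g a] e E He. apply HP.
  rewrite map_bind in He. now apply prefix_of_app_l in He.
Qed.

Lemma delta0_eq T U :
  definable_term vs T -> definable_term vs U -> Delta0 Xs vs (fun g => T g = U g).
Proof.
  intros [t Ht] [u Hu]. exists (FEq t u). split; [reflexivity|].
  intros g e E He HE; simpl. now rewrite (Ht g), (Hu g).
Qed.

Lemma delta0_lt T U :
  definable_term vs T -> definable_term vs U -> Delta0 Xs vs (fun g => T g < U g).
Proof.
  intros [t Ht] [u Hu]. exists (FLt t u). split; [reflexivity|].
  intros g e E He HE; simpl. now rewrite (Ht g), (Hu g).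
Qed.

Lemma delta0_mem T X : In X Xs -> definable_term vs T -> Delta0 Xs vs (fun g => mem (T g) X).
Proof.
  intros HX [t Ht]. apply In_nth_error in HX as [i Hi]. exists (FMem t i).
  split; [reflexivity|]. intros g e E He HE; simpl. now rewrite (Ht g), (HE i X).
Qed.

Lemma delta0_not P : Delta0 Xs vs P -> Delta0 Xs vs (fun g => ~ P g).
Proof.
  intros [A [HA HP]]. exists (FNot A). split; [exact HA|].
  intros g e E He HE; simpl. now rewrite (HP g).
Qed.

Lemma delta0_and P Q :
  Delta0 Xs vs P -> Delta0 Xs vs Q -> Delta0 Xs vs (fun g => P g /\ Q g).
Proof.
  intros [A [HA HP]] [B [HB HQ]]. exists (FAnd A B). split; [simpl; now rewrite HA, HB|].
  intros g e E He HE; simpl. now rewrite (HP g), (HQ g).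
Qed.

Lemma delta0_or P Q :
  Delta0 Xs vs P -> Delta0 Xs vs Q -> Delta0 Xs vs (fun g => P g \/ Q g).
Proof.
  intros [A [HA HP]] [B [HB HQ]]. exists (FOr A B). split; [simpl; now rewrite HA, HB|].
  intros g e E He HE; simpl. now rewrite (HP g), (HQ g).
Qed.

Lemma delta0_imp P Q :
  Delta0 Xs vs P -> Delta0 Xs vs Q -> Delta0 Xs vs (fun g => P g -> Q g).
Proof.
  intros [A [HA HP]] [B [HB HQ]]. exists (FImp A B). split; [simpl; now rewrite HA, HB|].
  intros g e E He HE; simpl. now rewrite (HP g), (HQ g).
Qed.

Lemma delta0_ex_lt T (Q : Env -> num M -> Prop) :
  definable_term vs T -> Delta0 Xs (bind vs) (fun p => Q (fst p) (snd p)) ->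
  Delta0 Xs vs (fun g => exists a, a < T g /\ Q g a).
Proof.
  intros [t Ht] [A [HA HQ]]. exists (FExB (length vs) t A). split; [exact HA|].
  intros g e E He HE; simpl. rewrite (Ht g e He).
  split; intros [a [La Qa]]; exists a; (split; [exact La|]);
    now apply (HQ (g, a) _ E (prefix_of_bind vs g a e He) HE).
Qed.

Lemma delta0_all_lt T (Q : Env -> num M -> Prop) :
  definable_term vs T -> Delta0 Xs (bind vs) (fun p => Q (fst p) (snd p)) ->
  Delta0 Xs vs (fun g => forall a, a < T g -> Q g a).
Proof.
  intros [t Ht] [A [HA HQ]]. exists (FAllB (length vs) t A). split; [exact HA|].
  intros g e E He HE; simpl. rewrite (Ht g e He).
  split; intros H a La;
    now apply (HQ (g, a) _ E (prefix_of_bind vs g a e He) HE), H.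
Qed.

End Closure.

Lemma delta0_ex_le {Env} Xs (vs : list (Env -> num M)) T (Q : Env -> num M -> Prop) :
  (forall g a, Q g a -> a <= T g) -> definable_term vs T ->
  Delta0 Xs (bind vs) (fun p => Q (fst p) (snd p)) ->
  Delta0 Xs vs (fun g => exists a, Q g a).
Proof.
  intros QT HT HQ. apply (delta0_ext _ _ _ (fun g => exists a, a <= T g /\ Q g a)).
  - intros g. split; intros [a Ha]; exists a; [auto|apply Ha].
  - apply delta0_ex_lt; [|exact HQ]. apply term_add; [exact HT|apply term_one].
Qed.

Lemma delta0_formula l Xs X0 (Q : num M -> num M -> Prop) :
  Delta0 Xs (bind (bind (params l))) (fun p => Q (snd (fst p)) (snd p)) ->
  exists A, bounded A = true /\ forall x w,
    sat M (upd (upd (fun i => nth i l 0) (length l) x) (S (length l)) w) (fun i => nth i Xs X0) A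
      <-> Q x w.
Proof.
  intros [A [HA HQ]]. exists A. split; [exact HA|]. intros x w.
  apply (HQ (tt, x, w)); [|apply prefix_of_nth].
  replace (length l) with (length (params l)) by apply length_map.
  rewrite <- length_bind at 1. apply prefix_of_bind, prefix_of_bind, prefix_of_params.
Qed.

End Definability.

Ltac definable :=
  cbv beta;
  lazymatch goal with
  | |- definable_term _ (fun g => zro) => apply term_zero
  | |- definable_term _ (fun g => one) => apply term_one
  | |- definable_term _ (fun g => add (@?T g) (@?U g)) => apply (term_add _ T U); definable
  | |- definable_term _ (fun g => mul (@?T g) (@?U g)) => apply (term_mul _ T U); definable
  | |- definable_term (bind ?vs) ?T =>
      lazymatch eval cbv beta iota delta [fst snd] in (fun g a => T (g, a)) with
      | fun g a => a => exact (term_snd vs)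
      | fun g a => @?U g => apply (term_fst vs U); definable
      end
  | |- definable_term (params _) _ => apply term_param; simpl; tauto
  | |- _ => assumption
  end.

Create HintDb delta0 discriminated.
#[export] Hint Extern 1 (definable_term _ _) => definable : delta0.
#[export] Hint Extern 1 (In _ _) => simpl; tauto : delta0.

Ltac delta0_connective :=
  cbv beta;
  lazymatch goal with
  | |- Delta0 ?Xs ?vs (fun g => exists a, lt a (@?T g) /\ @?Q g a) =>
      apply (delta0_ex_lt Xs vs T Q)
  | |- Delta0 ?Xs ?vs (fun g => forall a, lt a (@?T g) -> @?Q g a) =>
      apply (delta0_all_lt Xs vs T Q)
  | |- Delta0 ?Xs ?vs (fun g => @?P g /\ @?Q g) => apply (delta0_and Xs vs P Q)
  | |- Delta0 ?Xs ?vs (fun g => @?P g \/ @?Q g) => apply (delta0_or Xs vs P Q)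
  | |- Delta0 ?Xs ?vs (fun g => @?P g <-> @?Q g) =>
      apply (delta0_and Xs vs (fun g => P g -> Q g) (fun g => Q g -> P g))
  | |- Delta0 ?Xs ?vs (fun g => ~ @?P g) => apply (delta0_not Xs vs P)
  | |- Delta0 ?Xs ?vs (fun g => @?P g -> @?Q g) => apply (delta0_imp Xs vs P Q)
  | |- Delta0 ?Xs ?vs (fun g => @?T g = @?U g) => apply (delta0_eq Xs vs T U)
  | |- Delta0 ?Xs ?vs (fun g => lt (@?T g) (@?U g)) => apply (delta0_lt Xs vs T U)
  | |- Delta0 ?Xs ?vs (fun g => mem (@?T g) ?X) => apply (delta0_mem Xs vs T X)
  end.
#[export] Hint Extern 1 (Delta0 _ _ _) => delta0_connective : delta0.

Ltac delta0 := cbv beta; solve [auto 100 with delta0 nocore].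

(** * Induction and comprehension *)

Section Model.
Variable M : L2.
Hypothesis M_RCA0 : RCA0 M.
(* Induction and comprehension instances take an assignment of set variables, so they are
   vacuous in a structure without sets. *)
Variable some_set : sset M.

Lemma sigma1_induction l Xs (Q : num M -> num M -> Prop) :
  Delta0 Xs (bind (bind (params l))) (fun p => Q (snd (fst p)) (snd p)) ->
  (exists w, Q 0 w) ->
  (forall x, (exists w, Q x w) -> exists w, Q (x + 1) w) ->
  forall x, exists w, Q x w.
Proof.
  intros HQ Q0 QS. destruct (delta0_formula l Xs some_set Q HQ) as [A [HA K]].
  set (i := length l) in *. set (e := fun i => nth i l 0) in *.
  set (E := fun i => nth i Xs some_set) in *.
  assert (KQ : forall x, sat M (upd e i x) E (FEx (S i) A) <-> exists w, Q x w).
  { intros x; simpl. split; intros [w Hw]; exists w; now apply K. }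
  destruct M_RCA0 as (_ & Induction & _). intros x. apply KQ, Induction.
  - now exists (S i), A.
  - now apply KQ.
  - intros y Hy. now apply KQ, QS, KQ.
Qed.

Lemma delta1_comprehension l Xs (P Q : num M -> num M -> Prop) :
  Delta0 Xs (bind (bind (params l))) (fun p => P (snd (fst p)) (snd p)) ->
  Delta0 Xs (bind (bind (params l))) (fun p => Q (snd (fst p)) (snd p)) ->
  (forall x, (exists w, P x w) <-> (forall w, Q x w)) ->
  exists X, forall x, mem x X <-> exists w, P x w.
Proof.
  intros HP HQ PQ. destruct (delta0_formula l Xs some_set P HP) as [A [HA KA]].
  destruct (delta0_formula l Xs some_set Q HQ) as [B [HB KB]].
  set (i := length l) in *. set (e := fun i => nth i l 0) in *.
  set (E := fun i => nth i Xs some_set) in *.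
  assert (KP : forall x, sat M (upd e i x) E (FEx (S i) A) <-> exists w, P x w).
  { intros x; simpl. split; intros [w Hw]; exists w; now apply KA. }
  assert (KQ : forall x, sat M (upd e i x) E (FAll (S i) B) <-> forall w, Q x w).
  { intros x; simpl. split; intros Hw w; now apply KB. }
  destruct M_RCA0 as (_ & _ & Comprehension).
  destruct (Comprehension (FEx (S i) A) (FAll (S i) B) i) with e E as [X HX].
  - now exists (S i), A.
  - now exists (S i), B.
  - intros x. now rewrite KP, KQ.
  - exists X. intros x. now rewrite HX.
Qed.

Lemma delta0_induction l Xs (P : num M -> Prop) :
  Delta0 Xs (bind (params l)) (fun p => P (snd p)) ->
  P 0 -> (forall x, P x -> P (x + 1)) -> forall x, P x.
Proof.
  intros HP P0 PS x. apply delta0_fst in HP.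
  destruct (sigma1_induction l Xs (fun x _ => P x) HP) with x as [_ H]; [| |exact H].
  - now exists 0.
  - intros y [_ Hy]. exists 0. auto.
Qed.

Lemma delta0_comprehension l Xs (P : num M -> Prop) :
  Delta0 Xs (bind (params l)) (fun p => P (snd p)) -> exists X, forall x, mem x X <-> P x.
Proof.
  intros HP. apply delta0_fst in HP.
  destruct (delta1_comprehension l Xs (fun x _ => P x) (fun x _ => P x) HP HP) as [X HX].
  - intros x. split; [intros [_ H] _; exact H|intros H; exists 0; exact (H 0)].
  - exists X. intros x. rewrite HX. split; [intros [_ H]; exact H|intros H; now exists 0].
Qed.

(* Every number and every set of the local context is available as a parameter. *)
Ltac collect A acc :=
  match goal with
  | x : A |- _ => lazymatch acc with context [cons x _] => fail | _ => collect A (cons x acc) end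
  | _ => acc
  end.
Ltac numbers := let l := collect (num M) (@nil (num M)) in exact l.
Ltac sets := let l := collect (sset M) (@nil (sset M)) in exact l.

Tactic Notation "delta0_induct" ident(x) :=
  revert x; refine (delta0_induction ltac:(numbers) ltac:(sets) _ _ _ _); [delta0| |].
Tactic Notation "sigma1_induct" ident(x) :=
  revert x; refine (sigma1_induction ltac:(numbers) ltac:(sets) _ _ _ _); [delta0| |].
Tactic Notation "comprehend" constr(P) "as" ident(X) ident(HX) :=
  destruct (delta0_comprehension ltac:(numbers) ltac:(sets) P) as [X HX];
  [delta0|cbv beta in HX].

(** * Arithmetic in a model of RCA_0 *)

Lemma succ_neq_zero (n : num M) : n + 1 <> 0.
Proof. apply M_RCA0. Qed.

Lemma succ_inj (m n : num M) : m + 1 = n + 1 -> m = n.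
Proof. apply M_RCA0. Qed.

Lemma add_0_r (m : num M) : m + 0 = m.
Proof. apply M_RCA0. Qed.

Lemma add_succ_r (m n : num M) : m + (n + 1) = (m + n) + 1.
Proof. apply M_RCA0. Qed.

Lemma mul_0_r (m : num M) : m * 0 = 0.
Proof. apply M_RCA0. Qed.

Lemma mul_succ_r (m n : num M) : m * (n + 1) = m * n + m.
Proof. apply M_RCA0. Qed.

Lemma lt_0_r (m : num M) : ~ m < 0.
Proof. apply M_RCA0. Qed.

Lemma lt_succ_r (m n : num M) : m <= n <-> m < n \/ m = n.
Proof. apply M_RCA0. Qed.

Lemma add_assoc (a b x : num M) : a + (b + x) = (a + b) + x.
Proof.
  delta0_induct x.
  - now rewrite !add_0_r.
  - intros x IH. now rewrite !add_succ_r, IH.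
Qed.

Lemma add_0_l (x : num M) : 0 + x = x.
Proof.
  delta0_induct x.
  - apply add_0_r.
  - intros x IH. now rewrite add_succ_r, IH.
Qed.

Lemma add_1_l (x : num M) : 1 + x = x + 1.
Proof.
  delta0_induct x.
  - now rewrite add_0_r, add_0_l.
  - intros x IH. now rewrite add_succ_r, IH.
Qed.

Lemma add_comm (a x : num M) : a + x = x + a.
Proof.
  delta0_induct x.
  - now rewrite add_0_r, add_0_l.
  - intros x IH. now rewrite add_succ_r, IH, <- add_assoc, <- add_1_l, add_assoc.
Qed.

Lemma mul_add_distr_l (a b x : num M) : a * (b + x) = a * b + a * x.
Proof.
  delta0_induct x.
  - now rewrite mul_0_r, !add_0_r.
  - intros x IH. now rewrite add_succ_r, !mul_succ_r, IH, add_assoc.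
Qed.

Lemma mul_assoc (a b x : num M) : a * (b * x) = (a * b) * x.
Proof.
  delta0_induct x.
  - now rewrite !mul_0_r.
  - intros x IH. now rewrite !mul_succ_r, mul_add_distr_l, IH.
Qed.

Lemma mul_add_distr_r (a b x : num M) : (a + b) * x = a * x + b * x.
Proof.
  delta0_induct x.
  - now rewrite !mul_0_r, add_0_r.
  - intros x IH. rewrite !mul_succ_r, IH.
    rewrite <- !add_assoc. f_equal. rewrite !add_assoc. f_equal. apply add_comm.
Qed.

Lemma mul_0_l (x : num M) : 0 * x = 0.
Proof.
  delta0_induct x.
  - apply mul_0_r.
  - intros x IH. now rewrite mul_succ_r, IH, add_0_r.
Qed.

Lemma mul_1_l (x : num M) : 1 * x = x.
Proof.
  delta0_induct x.
  - apply mul_0_r.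
  - intros x IH. now rewrite mul_succ_r, IH.
Qed.

Lemma mul_comm (a x : num M) : a * x = x * a.
Proof.
  delta0_induct x.
  - now rewrite mul_0_r, mul_0_l.
  - intros x IH. now rewrite mul_succ_r, mul_add_distr_r, IH, mul_1_l.
Qed.

Lemma num_semi_ring : semi_ring_theory (0 : num M) 1 add mul eq.
Proof.
  constructor.
  - apply add_0_l.
  - apply add_comm.
  - apply add_assoc.
  - apply mul_1_l.
  - apply mul_0_l.
  - apply mul_comm.
  - apply mul_assoc.
  - apply mul_add_distr_r.
Qed.

Add Ring num_ring : num_semi_ring.

Lemma zero_or_succ (x : num M) : x = 0 \/ exists k, x = k + 1.
Proof.
  assert (H : exists k, x = 0 \/ x = k + 1).
  { sigma1_induct x.
    - exists 0. now left.
    - intros x _. exists x. now right. }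
  destruct H as [k [H|H]]; eauto.
Qed.

Lemma add_cancel_r (a b x : num M) : a + x = b + x -> a = b.
Proof.
  delta0_induct x.
  - now rewrite !add_0_r.
  - intros x IH H. rewrite !add_succ_r in H. apply IH, succ_inj, H.
Qed.

Lemma neq_add_succ (a k : num M) : a <> a + (k + 1).
Proof.
  intros H. apply (succ_neq_zero k), (add_cancel_r _ _ a). now rewrite add_0_l, add_comm.
Qed.

Lemma lt_add_succ (a x : num M) : a < a + (x + 1).
Proof.
  delta0_induct x.
  - rewrite add_succ_r, add_0_r. apply lt_succ_r. now right.
  - intros x IH. rewrite add_succ_r. apply lt_succ_r. now left.
Qed.

Lemma lt_exists_add (m n : num M) : m < n <-> exists k, n = m + (k + 1).
Proof.
  split; [|intros [k ->]; apply lt_add_succ].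
  intros H. enough (K : exists k, m < n -> n = m + (k + 1)).
  { destruct K as [k Hk]. eauto. }
  clear H. sigma1_induct n.
  - exists 0. intros K. now apply lt_0_r in K.
  - intros x [k Hk]. destruct (classic (m < x)) as [K|K].
    + exists (k + 1). intros _. rewrite (Hk K) at 1. ring.
    + exists 0. intros K'. apply lt_succ_r in K' as [K'| ->]; [easy|ring].
Qed.

Lemma le_exists_add (m n : num M) : m <= n <-> exists k, n = m + k.
Proof.
  rewrite lt_exists_add. split; intros [k Hk]; exists k.
  - apply succ_inj. rewrite Hk. ring.
  - rewrite Hk. ring.
Qed.

Lemma lt_irrefl (m : num M) : ~ m < m.
Proof. rewrite lt_exists_add. intros [k Hk]. exact (neq_add_succ _ _ Hk). Qed.

Lemma lt_trans (m n p : num M) : m < n -> n < p -> m < p.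
Proof.
  rewrite !lt_exists_add. intros [k ->] [l ->]. exists (k + 1 + l). ring.
Qed.

Lemma lt_le_trans (m n p : num M) : m < n -> n <= p -> m < p.
Proof.
  rewrite le_exists_add, !lt_exists_add. intros [k ->] [l ->]. exists (k + l). ring.
Qed.

Lemma le_lt_trans (m n p : num M) : m <= n -> n < p -> m < p.
Proof.
  rewrite le_exists_add, !lt_exists_add. intros [k ->] [l ->]. exists (k + l). ring.
Qed.

Lemma le_trans (m n p : num M) : m <= n -> n <= p -> m <= p.
Proof.
  rewrite !le_exists_add. intros [k ->] [l ->]. exists (k + l). ring.
Qed.

Lemma lt_le_incl (m n : num M) : m < n -> m <= n.
Proof. intros H. apply lt_succ_r. now left. Qed.

Lemma le_refl (m : num M) : m <= m.
Proof. apply lt_succ_r. now right. Qed.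

Lemma le_add_r (m n : num M) : m <= m + n.
Proof. apply le_exists_add. now exists n. Qed.

Lemma le_add_l (m n : num M) : m <= n + m.
Proof. apply le_exists_add. exists n. ring. Qed.

Lemma lt_trichotomy (m n : num M) : m < n \/ m = n \/ n < m.
Proof.
  delta0_induct n.
  - right. destruct (zero_or_succ m) as [->|[k ->]]; [now left|right].
    rewrite <- (add_0_l (k + 1)). apply lt_add_succ.
  - intros n [H|[->|H]].
    + left. now apply lt_le_incl.
    + left. apply le_refl.
    + right. apply lt_exists_add in H as [k ->].
      destruct (zero_or_succ k) as [->|[l ->]].
      * left. ring.
      * right. replace (n + (l + 1 + 1)) with ((n + 1) + (l + 1)) by ring. apply lt_add_succ.
Qed.

Lemma le_or_lt (m n : num M) : m <= n \/ n < m.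
Proof.
  destruct (lt_trichotomy m n) as [H|[->|H]].
  - left. now apply lt_le_incl.
  - left. apply le_refl.
  - now right.
Qed.

Lemma lt_asym (m n : num M) : m < n -> ~ n < m.
Proof. intros H K. exact (lt_irrefl m (lt_trans _ _ _ H K)). Qed.

Lemma le_not_lt (m n : num M) : m <= n -> ~ n < m.
Proof. intros H K. exact (lt_irrefl m (le_lt_trans _ _ _ H K)). Qed.

Lemma add_lt_mono_r (p m n : num M) : m < n <-> m + p < n + p.
Proof.
  rewrite !lt_exists_add. split; intros [k Hk]; exists k.
  - rewrite Hk. ring.
  - apply (add_cancel_r _ _ p). rewrite Hk. ring.
Qed.

Lemma mul_succ_lt_mono_r (p m n : num M) : m < n -> m * (p + 1) < n * (p + 1).
Proof.
  rewrite !lt_exists_add. intros [k ->]. exists (k * p + k + p). ring.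
Qed.

Lemma mul_succ_lt_cancel_r (p m n : num M) : m * (p + 1) < n * (p + 1) -> m < n.
Proof.
  intros H. destruct (lt_trichotomy m n) as [K|[->|K]]; [exact K| |].
  - now apply lt_irrefl in H.
  - apply (mul_succ_lt_mono_r p) in K. now apply lt_asym in H.
Qed.

Lemma mul_succ_cancel_r (p m n : num M) : m * (p + 1) = n * (p + 1) -> m = n.
Proof.
  intros H. destruct (lt_trichotomy m n) as [K|[K|K]]; [|exact K|];
    apply (mul_succ_lt_mono_r p) in K; rewrite H in K; now apply lt_irrefl in K.
Qed.

Lemma delta0_strong_induction l Xs (P : num M -> Prop) :
  Delta0 Xs (bind (params l)) (fun p => forall y, y < snd p -> P y) ->
  (forall x, (forall y, y < x -> P y) -> P x) -> forall x, P x.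
Proof.
  intros HP PS x. apply PS. revert x. refine (delta0_induction l Xs _ HP _ _).
  - intros y Hy. now apply lt_0_r in Hy.
  - intros x IH y Hy. apply PS. apply lt_succ_r in Hy as [Hy| ->]; [|exact IH].
    intros z Hz. apply IH. exact (lt_trans _ _ _ Hz Hy).
Qed.

Lemma delta0_least l Xs (P : num M -> Prop) :
  Delta0 Xs (bind (params l)) (fun p => forall y, y < snd p -> ~ P y) ->
  (exists x, P x) -> exists x, P x /\ forall y, y < x -> ~ P y.
Proof.
  intros HP [x Hx]. apply NNPP. intros N. revert x Hx.
  refine (delta0_strong_induction l Xs _ HP _).
  intros x IH Hx. apply N. now exists x.
Qed.

Tactic Notation "delta0_strong_induct" ident(x) :=
  revert x; refine (delta0_strong_induction ltac:(numbers) ltac:(sets) _ _ _); [delta0|].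
Tactic Notation "least_such" constr(P) "as" ident(x) ident(Hx) ident(Mx) :=
  destruct (delta0_least ltac:(numbers) ltac:(sets) P) as [x [Hx Mx]];
  [delta0| |cbv beta in Hx, Mx].

(** * Pairs, rationals and colourings *)

(* Twice the Cantor code, which unlike the code itself is given by a term. *)
Definition double_code (m n : num M) : num M := (m + n) * (m + n + 1) + (m + m).

Lemma term_double_code {Env} (vs : list (Env -> num M)) T U :
  definable_term vs T -> definable_term vs U ->
  definable_term vs (fun g => double_code (T g) (U g)).
Proof. intros HT HU. unfold double_code. definable. Qed.

#[local] Hint Resolve term_double_code : delta0.

Lemma double_code_lt (m n m' n' : num M) :
  m + n < m' + n' -> double_code m n < double_code m' n'.
Proof.
  rewrite !lt_exists_add. intros [k Hk]. unfold double_code. rewrite Hk.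
  exists ((m + n) * k + (m + n) * k + n + n + k * k + k + k + k + 1 + m' + m'). ring.
Qed.

Lemma double_code_mono (m n m' n' : num M) :
  m <= m' -> n <= n' -> double_code m n <= double_code m' n'.
Proof.
  rewrite !le_exists_add. intros [x ->] [y ->]. unfold double_code.
  exists ((x + y) * (m + n + (m + n) + 1 + (x + y)) + x + x). ring.
Qed.

Lemma double_inj (m n : num M) : m + m = n + n -> m = n.
Proof. intros H. apply (mul_succ_cancel_r 1). transitivity (m + m); [ring|]. rewrite H. ring. Qed.

Lemma double_le (m n : num M) : m + m <= n + n -> m <= n.
Proof.
  intros H. destruct (le_or_lt m n) as [K|K]; [exact K|].
  apply le_not_lt in H. destruct H. apply lt_exists_add in K as [k ->].
  apply lt_exists_add. exists (k + k + 1). ring.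
Qed.

Lemma double_code_inj (m n m' n' : num M) :
  double_code m n = double_code m' n' -> m = m' /\ n = n'.
Proof.
  intros H. destruct (lt_trichotomy (m + n) (m' + n')) as [K|[K|K]].
  - apply double_code_lt in K. rewrite H in K. now apply lt_irrefl in K.
  - unfold double_code in H. rewrite K, (add_comm _ (m + m)), (add_comm _ (m' + m')) in H.
    apply add_cancel_r, double_inj in H. subst m'. split; [reflexivity|].
    rewrite !(add_comm m) in K. now apply add_cancel_r in K.
  - apply double_code_lt in K. rewrite H in K. now apply lt_irrefl in K.
Qed.

Lemma PairR_ex (m n : num M) : exists k, PairR M m n k.
Proof.
  assert (H : forall x : num M, exists w, x * (x + 1) = w + w).
  { intros x. sigma1_induct x.
    - exists 0. ring.
    - intros x [w Hw]. exists (w + (x + 1)).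
      transitivity (x * (x + 1) + (x + 1) + (x + 1)); [ring|]. rewrite Hw. ring. }
  destruct (H (m + n)) as [w Hw]. exists (w + m). unfold PairR. rewrite Hw. ring.
Qed.

Lemma PairR_inj (m n m' n' k : num M) : PairR M m n k -> PairR M m' n' k -> m = m' /\ n = n'.
Proof. intros H H'. apply double_code_inj. unfold double_code, PairR in *. congruence. Qed.

Lemma PairR_le_l (m n k : num M) : PairR M m n k -> m <= k.
Proof. intros H. apply double_le. rewrite <- H. apply le_add_l. Qed.

Lemma PairR_le_r (m n k : num M) : PairR M m n k -> n <= k.
Proof.
  intros H. apply double_le. rewrite <- H. apply le_exists_add.
  destruct (zero_or_succ n) as [->|[n' ->]].
  - exists (m * m + m + m + m). ring.
  - exists (m * m + m * n' + m * n' + n' * n' + n' + m * (1 + 1 + 1 + 1 + 1)). ring.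
Qed.

Lemma PairR_le_double_code (m n k : num M) : PairR M m n k -> k <= double_code m n.
Proof. intros H. unfold double_code. rewrite H. apply le_add_r. Qed.

Lemma Code3_ex (p q i : num M) : exists x, Code3 M p q i x.
Proof. destruct (PairR_ex p q) as [u Hu], (PairR_ex u i) as [x Hx]. now exists x, u. Qed.

Lemma Code3_inj (p q i p' q' i' x : num M) :
  Code3 M p q i x -> Code3 M p' q' i' x -> p = p' /\ q = q' /\ i = i'.
Proof.
  intros [u [Hu Hx]] [u' [Hu' Hx']]. destruct (PairR_inj _ _ _ _ _ Hx Hx') as [-> ->].
  destruct (PairR_inj _ _ _ _ _ Hu Hu') as [-> ->]. auto.
Qed.

Lemma Code3_le (p q i x : num M) : Code3 M p q i x -> p <= x /\ q <= x /\ i <= x.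
Proof.
  intros [u [Hu Hx]].
  pose proof (PairR_le_l _ _ _ Hu). pose proof (PairR_le_r _ _ _ Hu).
  pose proof (PairR_le_l _ _ _ Hx). pose proof (PairR_le_r _ _ _ Hx).
  eauto using le_trans.
Qed.

Lemma Code3_le_double_code (p q i x : num M) :
  Code3 M p q i x -> x <= double_code (double_code p q) i.
Proof.
  intros [u [Hu Hx]]. apply PairR_le_double_code in Hu, Hx.
  eapply le_trans; [exact Hx|]. apply double_code_mono; [exact Hu|apply le_refl].
Qed.

Section DefinablePairs.
Context {Env : Type} (Xs : list (sset M)) (vs : list (Env -> num M)).
Implicit Types T U V W : Env -> num M.

Lemma delta0_PairR T U V :
  definable_term vs T -> definable_term vs U -> definable_term vs V ->
  Delta0 Xs vs (fun g => PairR M (T g) (U g) (V g)).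
Proof. unfold PairR. delta0. Qed.

Lemma delta0_Code3 T U V W :
  definable_term vs T -> definable_term vs U -> definable_term vs V -> definable_term vs W ->
  Delta0 Xs vs (fun g => Code3 M (T g) (U g) (V g) (W g)).
Proof.
  intros. apply delta0_ex_le with (T := W).
  - intros g u [_ Hx]. exact (PairR_le_l _ _ _ Hx).
  - assumption.
  - unfold PairR. delta0.
Qed.

End DefinablePairs.

#[local] Hint Resolve delta0_PairR delta0_Code3 : delta0.

Lemma delta0_ex_Code3 {Env} Xs (vs : list (Env -> num M)) T
    (Q : Env -> num M -> num M -> num M -> Prop) :
  definable_term vs T ->
  Delta0 Xs (bind (bind (bind vs)))
    (fun p => Q (fst (fst (fst p))) (snd (fst (fst p))) (snd (fst p)) (snd p)) ->
  Delta0 Xs vs (fun g => exists a c b, Code3 M a c b (T g) /\ Q g a c b).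
Proof.
  intros HT HQ.
  apply delta0_ex_le with (T := T); [|exact HT|].
  { intros g a (c & b & H & _). now apply Code3_le in H. }
  apply delta0_ex_le with (T := fun p => T (fst p)); [|delta0|].
  { intros g c (b & H & _). now apply Code3_le in H. }
  apply delta0_ex_le with (T := fun p => T (fst (fst p))); [|delta0|].
  { intros g b [H _]. now apply Code3_le in H. }
  apply delta0_and; [delta0|exact HQ].
Qed.

Section DefinableFractions.
Context {Env : Type} (Xs : list (sset M)) (vs : list (Env -> num M)).
Implicit Types T U : Env -> num M.

Lemma delta0_fractions T U (Q : num M -> num M -> num M -> num M -> num M -> num M -> Prop) :
  definable_term vs T -> definable_term vs U ->
  (Delta0 Xs (bind (bind (bind (bind (bind (bind vs)))))) (fun p =>
     Q (snd (fst (fst (fst (fst (fst p)))))) (snd (fst (fst (fst (fst p)))))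
       (snd (fst (fst (fst p)))) (snd (fst (fst p))) (snd (fst p)) (snd p))) ->
  Delta0 Xs vs (fun g => exists a c b a' c' b',
    Code3 M a c b (T g) /\ Code3 M a' c' b' (U g) /\ Q a c b a' c' b').
Proof.
  intros HT HU HQ.
  apply (delta0_ext _ _ _ (fun g => exists a c b, Code3 M a c b (T g) /\
    exists a' c' b', Code3 M a' c' b' (U g) /\ Q a c b a' c' b')).
  { intros g. split.
    - intros (a & c & b & a' & c' & b' & H & H' & K). exists a, c, b. split; [exact H|].
      now exists a', c', b'.
    - intros (a & c & b & H & a' & c' & b' & H' & K). now exists a, c, b, a', c', b'. }
  apply delta0_ex_Code3; [exact HT|]. apply delta0_ex_Code3; [delta0|exact HQ].
Qed.

Lemma delta0_qlt T U :
  definable_term vs T -> definable_term vs U -> Delta0 Xs vs (fun g => qlt M (T g) (U g)).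
Proof. intros HT HU. apply delta0_fractions; delta0. Qed.

Lemma delta0_qeqv T U :
  definable_term vs T -> definable_term vs U -> Delta0 Xs vs (fun g => qeqv M (T g) (U g)).
Proof. intros HT HU. apply delta0_fractions; delta0. Qed.

End DefinableFractions.

#[local] Hint Resolve delta0_qlt delta0_qeqv : delta0.

Section DefinableRationals.
Context {Env : Type} (Xs : list (sset M)) (vs : list (Env -> num M)).
Implicit Types T U V : Env -> num M.

Lemma delta0_IsQ T : definable_term vs T -> Delta0 Xs vs (fun g => IsQ M (T g)).
Proof.
  intros HT. apply delta0_and; [|delta0].
  apply (delta0_ext _ _ _ (fun g => exists a c b, Code3 M a c b (T g) /\ b = b)).
  { intros g. split; intros (a & c & b & H); exists a, c, b; [now split|apply H]. }
  apply delta0_ex_Code3; delta0.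
Qed.

Lemma delta0_Col F T U V :
  In F Xs -> definable_term vs T -> definable_term vs U -> definable_term vs V ->
  Delta0 Xs vs (fun g => Col M F (T g) (U g) (V g)).
Proof.
  intros HF HT HU HV.
  apply delta0_ex_le with (T := fun g => double_code (double_code (T g) (U g)) (V g)).
  - intros g x [H _]. now apply Code3_le_double_code.
  - delta0.
  - delta0.
Qed.

Lemma delta0_HRel H T U :
  In H Xs -> definable_term vs T -> definable_term vs U ->
  Delta0 Xs vs (fun g => HRel M H (T g) (U g)).
Proof.
  intros HH HT HU. apply delta0_ex_le with (T := fun g => double_code (T g) (U g)).
  - intros g x [Hx _]. now apply PairR_le_double_code.
  - delta0.
  - delta0.
Qed.

End DefinableRationals.

#[local] Hint Resolve delta0_IsQ delta0_Col delta0_HRel : delta0.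

Lemma qlt_irrefl (p : num M) : ~ qlt M p p.
Proof.
  intros (a & c & b & a' & c' & b' & H & H' & L).
  destruct (Code3_inj _ _ _ _ _ _ _ H H') as (<- & <- & <-). now apply lt_irrefl in L.
Qed.

Lemma qlt_trans (p q r : num M) : qlt M p q -> qlt M q r -> qlt M p r.
Proof.
  intros (a & c & b & a' & c' & b' & Hp & Hq & L) (a0 & c0 & b0 & a'' & c'' & b'' & Hq0 & Hr & L').
  destruct (Code3_inj _ _ _ _ _ _ _ Hq Hq0) as (<- & <- & <-).
  exists a, c, b, a'', c'', b''. split; [exact Hp|split; [exact Hr|]].
  apply (mul_succ_lt_cancel_r b').
  apply (add_lt_mono_r (a' * (b + 1) * (b'' + 1) + c' * (b + 1) * (b'' + 1))).
  apply lt_exists_add in L as [k Hk], L' as [l Hl]. apply lt_exists_add.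
  exists ((k + 1) * b'' + k + (l + 1) * b + l + 1).
  transitivity ((a' * (b + 1) + c * (b' + 1)) * (b'' + 1)
                + (a'' * (b' + 1) + c' * (b'' + 1)) * (b + 1)); [ring|].
  rewrite Hk, Hl. ring.
Qed.

Lemma qgt_trans (p q r : num M) : qlt M q p -> qlt M r q -> qlt M r p.
Proof. intros L L'. exact (qlt_trans _ _ _ L' L). Qed.

Lemma qlt_asym (p q : num M) : qlt M p q -> ~ qlt M q p.
Proof. intros H K. exact (qlt_irrefl p (qlt_trans _ _ _ H K)). Qed.

Lemma qlt_total (p q : num M) : IsQ M p -> IsQ M q -> qlt M p q \/ p = q \/ qlt M q p.
Proof.
  intros [(a & c & b & Hp) Mp] [(a' & c' & b' & Hq) Mq].
  destruct (lt_trichotomy (a * (b' + 1) + c' * (b + 1)) (a' * (b + 1) + c * (b' + 1)))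
    as [L|[L|L]].
  - left. now exists a, c, b, a', c', b'.
  - right; left. destruct (lt_trichotomy p q) as [K|[K|K]]; [|exact K|].
    + destruct (Mq p K). now exists a, c, b, a', c', b'.
    + destruct (Mp q K). now exists a', c', b', a, c, b.
  - right; right. now exists a', c', b', a, c, b.
Qed.

(** * Codes for finite sets *)

Definition divides (d a : num M) : Prop := exists y, a = y * d.

(* A Bezout identity, with the negative terms moved to the other side. *)
Definition coprime (p q : num M) : Prop :=
  exists u v u' v', 1 + u * p + v * q = u' * p + v' * q.

Lemma divides_mul_l (d a x : num M) : divides d a -> divides d (x * a).
Proof. intros [y ->]. exists (x * y). ring. Qed.

Lemma divides_add_cancel (d a x : num M) : divides d (a + x) -> divides d x -> divides d a.
Proof.
  intros [z Hz] [y ->]. destruct (le_or_lt y z) as [K|K].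
  - apply le_exists_add in K as [r ->]. exists r. apply (add_cancel_r _ _ (y * d)).
    rewrite Hz. ring.
  - apply lt_exists_add in K as [r ->]. exists 0. rewrite mul_0_l.
    assert (E : a + (r + 1) * d = 0).
    { apply (add_cancel_r _ _ (z * d)). rewrite add_0_l. etransitivity; [|exact Hz]. ring. }
    destruct (zero_or_succ a) as [->|[a' ->]]; [reflexivity|].
    destruct (succ_neq_zero (a' + (r + 1) * d)). rewrite <- E. ring.
Qed.

Lemma coprime_sym (p q : num M) : coprime p q -> coprime q p.
Proof.
  intros (u & v & u' & v' & H). exists v, u, v', u'.
  transitivity (1 + u * p + v * q); [ring|]. rewrite H. ring.
Qed.

Lemma coprime_divides_mul (p q a : num M) : coprime p q -> divides p (a * q) -> divides p a.
Proof.
  intros (u & v & u' & v' & H) [z Hz].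
  apply (divides_add_cancel p a ((a * u + v * z) * p)); [|now eexists].
  exists (u' * a + v' * z).
  transitivity (a * (1 + u * p) + v * (z * p)); [ring|]. rewrite <- Hz.
  transitivity (a * (1 + u * p + v * q)); [ring|]. rewrite H.
  transitivity (u' * a * p + v' * (a * q)); [ring|]. rewrite Hz. ring.
Qed.

Definition modulus (b i : num M) : num M := (i + 1) * (b + 1) + 1.

Lemma coprime_modulus_lt (b i m : num M) :
  divides (m + 1) (b + 1) -> coprime (modulus b i) (modulus b (i + (m + 1))).
Proof.
  intros [y Hy]. unfold modulus. rewrite Hy.
  exists ((i + 1) * y * (i + (m + 1) + 1)), 0, 1, ((i + 1) * (i + 1) * y). ring.
Qed.

Lemma coprime_modulus (k b i j : num M) :
  (forall m, m < k -> divides (m + 1) (b + 1)) -> i < k -> j < k -> i <> j ->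
  coprime (modulus b i) (modulus b j).
Proof.
  intros Hb Hi Hj N.
  assert (Hm : forall n m, n + (m + 1) < k -> divides (m + 1) (b + 1)).
  { intros n m L. apply Hb, (lt_trans _ (n + (m + 1))); [|exact L].
    apply lt_exists_add. exists n. ring. }
  destruct (lt_trichotomy i j) as [K|[K|K]]; [|easy|]; apply lt_exists_add in K as [m ->].
  - apply coprime_modulus_lt. eauto.
  - apply coprime_sym, coprime_modulus_lt. eauto.
Qed.

Lemma modulus_divides_mul (k b a i n : num M) :
  (forall m, m < k -> divides (m + 1) (b + 1)) -> i < k -> n < k ->
  divides (modulus b i) (a * modulus b n) <-> divides (modulus b i) a \/ i = n.
Proof.
  intros Hb Hi Hn. split.
  - intros H. destruct (classic (i = n)) as [E|N]; [now right|left].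
    apply (coprime_divides_mul _ (modulus b n)); [|exact H]. now apply (coprime_modulus k).
  - intros [H| ->]; [|now exists a]. rewrite mul_comm. now apply divides_mul_l.
Qed.

Lemma modulus_not_divides_one (b i : num M) : ~ divides (modulus b i) 1.
Proof.
  intros [y Hy]. destruct (zero_or_succ y) as [->|[z ->]].
  - rewrite mul_0_l in Hy. apply (succ_neq_zero 0). now rewrite add_0_l.
  - apply (neq_add_succ 1 (z * modulus b i + i * b + i + b)). rewrite Hy at 1.
    unfold modulus. ring.
Qed.

Section DefinableDivisibility.
Context {Env : Type} (Xs : list (sset M)) (vs : list (Env -> num M)).
Implicit Types T U V : Env -> num M.

Lemma delta0_divides_succ T U :
  definable_term vs T -> definable_term vs U ->
  Delta0 Xs vs (fun g => divides (T g + 1) (U g)).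
Proof.
  intros HT HU. apply delta0_ex_le with (T := U); [|exact HU|delta0].
  intros g y ->. apply le_exists_add. exists (y * T g). ring.
Qed.

Lemma delta0_divides_modulus T U V :
  definable_term vs T -> definable_term vs U -> definable_term vs V ->
  Delta0 Xs vs (fun g => divides (modulus (T g) (U g)) (V g)).
Proof.
  intros HT HU HV. apply (delta0_divides_succ (fun g => (U g + 1) * (T g + 1))); delta0.
Qed.

End DefinableDivisibility.

#[local] Hint Resolve delta0_divides_succ delta0_divides_modulus : delta0.

Lemma common_multiple (k : num M) : exists b, forall i, i < k -> divides (i + 1) (b + 1).
Proof.
  sigma1_induct k.
  - exists 0. intros i Hi. now apply lt_0_r in Hi.
  - intros k [b IH]. exists (k * b + k + b). intros i Hi.
    replace (k * b + k + b + 1) with ((k + 1) * (b + 1)) by ring.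
    apply lt_succ_r in Hi as [Hi| ->].
    + now apply divides_mul_l, IH.
    + exists (b + 1). ring.
Qed.

(* As for Goedel's beta function, but membership is divisibility by a modulus: [b + 1] is
   divisible by [1, ..., k], which makes the moduli with index below [k] pairwise coprime. *)
Definition fin_mem (i c : num M) : Prop :=
  exists a b k, Code3 M a b k c /\ (i < k /\ divides (modulus b i) a).

Lemma fin_mem_le (i c : num M) : fin_mem i c -> i <= c.
Proof.
  intros (a & b & k & C & L & _). apply lt_le_incl, (lt_le_trans _ k); [exact L|].
  now apply Code3_le in C.
Qed.

Lemma finite_set_code (X : sset M) (k : num M) :
  exists c, forall i, fin_mem i c <-> i < k /\ mem i X.
Proof.
  destruct (common_multiple k) as [b Hb].
  assert (H : forall n, exists a, forall i, i < k ->
    (divides (modulus b i) a <-> i < n /\ mem i X)).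
  { intros n. sigma1_induct n.
    - exists 1. intros i _. split.
      + intros D. now apply modulus_not_divides_one in D.
      + intros [L _]. now apply lt_0_r in L.
    - intros n [a Ha]. destruct (classic (n < k /\ mem n X)) as [[Hn Xn]|N].
      + exists (a * modulus b n). intros i Hi.
        rewrite (modulus_divides_mul k), (Ha i Hi), lt_succ_r by assumption.
        split; [intros [[L Xi]| ->]|]; tauto.
      + exists a. intros i Hi. rewrite (Ha i Hi), lt_succ_r.
        split; [tauto|intros [[L| ->] Xi]; tauto]. }
  destruct (H k) as [a Ha], (Code3_ex a b k) as [c C]. exists c. intros i. split.
  - intros (a' & b' & k' & C' & L & D).
    destruct (Code3_inj _ _ _ _ _ _ _ C C') as (<- & <- & <-). now apply Ha.
  - intros [L Xi]. exists a, b, k. split; [exact C|split; [exact L|now apply Ha]].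
Qed.

Definition maps (c q s : num M) : Prop := fin_mem (double_code q s) c.

Lemma le_double_code_r (m n : num M) : n <= double_code m n.
Proof.
  apply le_exists_add. unfold double_code. exists ((m + n) * (m + n) + m + m + m). ring.
Qed.

Lemma maps_le (c q s : num M) : maps c q s -> s <= c.
Proof. intros H. apply fin_mem_le in H. exact (le_trans _ _ _ (le_double_code_r q s) H). Qed.

Lemma delta0_maps {Env} Xs (vs : list (Env -> num M)) T U V :
  definable_term vs T -> definable_term vs U -> definable_term vs V ->
  Delta0 Xs vs (fun g => maps (T g) (U g) (V g)).
Proof.
  intros HT HU HV. apply delta0_ex_Code3; [exact HT|]. unfold double_code. delta0.
Qed.

#[local] Hint Resolve delta0_maps : delta0.

Section MapQuantifiers.
Context {Env : Type} (Xs : list (sset M)) (vs : list (Env -> num M)).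
Implicit Types T U : Env -> num M.

Lemma delta0_ex_maps T U :
  definable_term vs T -> definable_term vs U ->
  Delta0 Xs vs (fun g => exists s, maps (T g) (U g) s).
Proof.
  intros HT HU. apply delta0_ex_le with (T := T); [|exact HT|delta0].
  intros g s. apply maps_le.
Qed.

Lemma delta0_all_maps T U (Q : Env -> num M -> Prop) :
  definable_term vs T -> definable_term vs U ->
  Delta0 Xs (bind vs) (fun p => Q (fst p) (snd p)) ->
  Delta0 Xs vs (fun g => forall s, maps (T g) (U g) s -> Q g s).
Proof.
  intros HT HU HQ.
  apply (delta0_ext _ _ _ (fun g => forall s, s <= T g -> maps (T g) (U g) s -> Q g s));
    [|delta0].
  intros g. split; [auto|]. intros H s Hs. apply H; [exact (maps_le _ _ _ Hs)|exact Hs].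
Qed.

End MapQuantifiers.

#[local] Hint Resolve delta0_ex_maps delta0_all_maps : delta0.

Lemma finite_map_extension (n c t : num M) :
  exists c', forall q s, maps c' q s <-> (q < n /\ maps c q s) \/ (q = n /\ s = t).
Proof.
  comprehend (fun x => (exists q, q < n /\ exists s, s <= c /\ (x = double_code q s /\ maps c q s))
                       \/ x = double_code n t) as X HX.
  destruct (finite_set_code X (double_code n (c + t) + 1)) as [c' C]. exists c'.
  intros q s. unfold maps at 1. rewrite C, HX. split.
  - intros [_ [(r & L & u & _ & E & H)|E]]; apply double_code_inj in E as [-> ->]; auto.
  - intros [[L H]|[-> ->]].
    + pose proof (maps_le _ _ _ H) as Ls. split; [|left; now eauto 10].
      apply double_code_mono; [now apply lt_le_incl|].
      exact (le_trans _ _ _ Ls (le_add_r _ _)).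
    + split; [|now right]. apply double_code_mono; [apply le_refl|apply le_add_l].
Qed.

(** * Definable linear orders *)

Section LinearOrder.
Variable R : num M -> num M -> Prop.
Hypothesis delta0_R : forall Env Xs (vs : list (Env -> num M)) T U,
  definable_term vs T -> definable_term vs U -> Delta0 Xs vs (fun g => R (T g) (U g)).
Hypothesis R_irrefl : forall x, ~ R x x.
Hypothesis R_trans : forall x y z, R x y -> R y z -> R x z.
Variable X : sset M.
Hypothesis R_total : forall x y, mem x X -> mem y X -> R x y \/ x = y \/ R y x.
Hypothesis X_nonempty : exists x, mem x X.

Lemma maximum_below (k : num M) :
  exists m, mem m X /\ forall x, x < k -> mem x X -> x = m \/ R x m.
Proof.
  sigma1_induct k.
  - destruct X_nonempty as [m Hm]. exists m. split; [exact Hm|].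
    intros x L. now apply lt_0_r in L.
  - intros k (m & Hm & Mm).
    assert (K : exists m', mem m' X /\ (m = m' \/ R m m') /\ (mem k X -> k = m' \/ R k m')).
    { destruct (classic (mem k X)) as [Hk|Hk]; [|now exists m; repeat split; auto].
      destruct (R_total m k Hm Hk) as [T|[T|T]]; [exists k|exists m..]; auto. }
    destruct K as (m' & Hm' & Lm & Lk). exists m'. split; [exact Hm'|].
    intros x L Hx. apply lt_succ_r in L as [L| ->]; [|auto].
    destruct (Mm x L Hx) as [->|T]; [exact Lm|]. destruct Lm as [->|T']; eauto.
Qed.

Hypothesis X_no_maximum : forall x, mem x X -> exists y, mem y X /\ R x y.

Lemma strict_bound_below (k : num M) :
  exists s, mem s X /\ forall x, x < k -> mem x X -> R x s.
Proof.
  destruct (maximum_below k) as (m & Hm & Mm), (X_no_maximum m Hm) as (s & Hs & L).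
  exists s. split; [exact Hs|]. intros x Lx Hx. destruct (Mm x Lx Hx) as [->|T]; eauto.
Qed.

Lemma infinite_ascending_subset : exists Y,
  (forall x, mem x Y -> mem x X) /\ Infinite M Y /\
  forall p q, mem p Y -> mem q Y -> (p < q <-> R p q).
Proof.
  comprehend (fun s => mem s X /\ forall t, t < s -> mem t X -> R t s) as Y HY.
  exists Y. split; [intros x Hx; now apply HY|split].
  - intros [k Hk].
    least_such (fun s => mem s X /\ forall t, t < k -> mem t X -> R t s) as s Hs Ms.
    { apply strict_bound_below. }
    destruct Hs as [Hs Bs]. assert (ks : ~ s < k) by (intros L; now apply (R_irrefl s), Bs).
    apply ks, Hk, HY. split; [exact Hs|]. intros t Lt Ht.
    destruct (classic (t < k)) as [L|L]; [auto|].
    assert (N : exists x, x < k /\ mem x X /\ ~ R x t).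
    { apply NNPP. intros N. apply (Ms t Lt). split; [exact Ht|].
      intros x Lx Hx. apply NNPP. intros T. eauto. }
    destruct N as (x & Lx & Hx & N). specialize (Bs x Lx Hx).
    destruct (R_total x t Hx Ht) as [T|[->|T]]; [easy|exact Bs|eauto].
  - assert (A : forall p q, mem p Y -> mem q Y -> p < q -> R p q).
    { intros p q Hp Hq L. apply HY in Hp, Hq. now apply Hq. }
    intros p q Hp Hq. split; [auto|]. intros T.
    destruct (lt_trichotomy p q) as [L|[->|L]]; [exact L|now apply R_irrefl in T|].
    destruct (R_irrefl p). eauto.
Qed.

End LinearOrder.

(** * Dense suborders of the rationals *)

Lemma delta0_qgt {Env} Xs (vs : list (Env -> num M)) T U :
  definable_term vs T -> definable_term vs U -> Delta0 Xs vs (fun g => qlt M (U g) (T g)).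
Proof. intros HT HU. now apply delta0_qlt. Qed.

Section DenseSuborder.
Variable S : sset M.
Hypothesis S_dense : DLOwoEnd M S.

Lemma dense_qlt_total p q : mem p S -> mem q S -> qlt M p q \/ p = q \/ qlt M q p.
Proof. intros Hp Hq. apply qlt_total; now apply S_dense. Qed.

Lemma dense_qgt_total p q : mem p S -> mem q S -> qlt M q p \/ p = q \/ qlt M p q.
Proof. intros Hp Hq. destruct (dense_qlt_total p q Hp Hq) as [?|[?|?]]; auto. Qed.

Lemma dense_no_maximum p : mem p S -> exists q, mem q S /\ qlt M p q.
Proof.
  intros Hp. destruct S_dense as (_ & _ & _ & NoEnd).
  destruct (NoEnd p Hp) as (r & q & _ & Hq & _ & L). now exists q.
Qed.

Lemma dense_no_minimum p : mem p S -> exists q, mem q S /\ qlt M q p.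
Proof.
  intros Hp. destruct S_dense as (_ & _ & _ & NoEnd).
  destruct (NoEnd p Hp) as (q & r & Hq & _ & L & _). now exists q.
Qed.

Lemma dense_cut (L U : sset M) (k : num M) :
  (forall x, mem x L -> mem x S /\ x < k) -> (forall x, mem x U -> mem x S /\ x < k) ->
  (forall x y, mem x L -> mem y U -> qlt M x y) ->
  exists s, mem s S /\ (forall x, mem x L -> qlt M x s) /\ (forall y, mem y U -> qlt M s y).
Proof.
  intros HL HU LU. destruct S_dense as (_ & NS & Dense & _).
  destruct (classic (exists x, mem x L)) as [NL|NL].
  - destruct (classic (exists y, mem y U)) as [NU|NU].
    + destruct (maximum_below (qlt M) (@delta0_qlt) qlt_trans L) with k
        as (l & Hl & Ml); [|exact NL|].
      { intros x y Hx Hy. apply dense_qlt_total; [now apply HL|now apply HL]. }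
      destruct (maximum_below (fun p q => qlt M q p) (@delta0_qgt) qgt_trans U) with k
        as (u & Hu & Mu); [|exact NU|].
      { intros x y Hx Hy. apply dense_qgt_total; [now apply HU|now apply HU]. }
      destruct (Dense l u) as (s & Hs & ls & su); [now apply HL|now apply HU|auto|].
      exists s. split; [exact Hs|split].
      * intros x Hx. destruct (Ml x) as [->|T]; [now apply HL|exact Hx|exact ls|].
        exact (qlt_trans _ _ _ T ls).
      * intros y Hy. destruct (Mu y) as [->|T]; [now apply HU|exact Hy|exact su|].
        exact (qlt_trans _ _ _ su T).
    + destruct (strict_bound_below (qlt M) (@delta0_qlt) qlt_trans S
        dense_qlt_total NS dense_no_maximum k) as (s & Hs & Bs).
      exists s. split; [exact Hs|split]; [|intros y Hy; destruct NU; eauto].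
      intros x Hx. now apply Bs; apply HL.
  - destruct (strict_bound_below (fun p q => qlt M q p) (@delta0_qgt) qgt_trans S
      dense_qgt_total NS dense_no_minimum k) as (s & Hs & Bs).
    exists s. split; [exact Hs|split]; [intros x Hx; destruct NL; eauto|].
    intros y Hy. now apply Bs; apply HU.
Qed.

(* Adding to [L] the elements of the cut with code below [j] makes the next one large. *)
Lemma dense_cut_large (L U : sset M) (k j : num M) :
  (forall x, mem x L -> mem x S /\ x < k) -> (forall x, mem x U -> mem x S /\ x < k) ->
  (forall x y, mem x L -> mem y U -> qlt M x y) ->
  exists s, mem s S /\ j <= s /\
    (forall x, mem x L -> qlt M x s) /\ (forall y, mem y U -> qlt M s y).
Proof.
  intros HL HU LU.
  comprehend (fun x => mem x L \/ (x < j /\ mem x S /\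
    (forall l, l < k -> mem l L -> qlt M l x) /\ forall u, u < k -> mem u U -> qlt M x u))
    as L' HL'.
  destruct (dense_cut L' U (k + j)) as (s & Hs & Ls & Us).
  - intros x Hx. apply HL' in Hx as [Hx|(Lx & Hx & _)].
    + split; [now apply HL|]. apply (lt_le_trans _ k); [now apply HL|apply le_add_r].
    + split; [exact Hx|]. apply (lt_le_trans _ j); [exact Lx|apply le_add_l].
  - intros x Hx. split; [now apply HU|]. apply (lt_le_trans _ k); [now apply HU|apply le_add_r].
  - intros x y Hx Hy. apply HL' in Hx as [Hx|(_ & _ & _ & K)]; [auto|].
    apply K; [now apply HU|exact Hy].
  - assert (Ls' : forall x, mem x L -> qlt M x s) by (intros x Hx; apply Ls, HL'; now left).
    exists s. split; [exact Hs|]. split; [|now split].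
    destruct (le_or_lt j s) as [K|K]; [exact K|]. destruct (qlt_irrefl s). apply Ls, HL'.
    right. repeat split; auto.
Qed.

End DenseSuborder.

(** * Recursion by least choice *)

Section GreedyChoice.
Variable dom : num M -> Prop.
Variable compat : num M -> num M -> num M -> num M -> Prop.
Variable S : sset M.
Hypothesis delta0_dom : forall Env Xs (vs : list (Env -> num M)) T,
  definable_term vs T -> Delta0 Xs vs (fun g => dom (T g)).
Hypothesis delta0_compat : forall Env Xs (vs : list (Env -> num M)) T U V W,
  definable_term vs T -> definable_term vs U -> definable_term vs V -> definable_term vs W ->
  Delta0 Xs vs (fun g => compat (T g) (U g) (V g) (W g)).

(* [n <= t] makes the range of the chosen function decidable. *)
Definition candidate (c n t : num M) : Prop :=
  mem t S /\ n <= t /\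
  forall q, q < n -> dom q -> forall s, maps c q s -> compat q s n t.

Definition least_candidate (c n t : num M) : Prop :=
  candidate c n t /\ forall t', t' < t -> ~ candidate c n t'.

Definition greedy_below (n c : num M) : Prop :=
  forall q, q < n -> dom q ->
    (exists s, maps c q s) /\ forall s, maps c q s -> least_candidate c q s.

Hypothesis extendable : forall n c, dom n ->
  (forall q s, q < n -> dom q -> maps c q s -> candidate c q s) -> exists t, candidate c n t.

Lemma delta0_candidate {Env} Xs (vs : list (Env -> num M)) T U V :
  In S Xs -> definable_term vs T -> definable_term vs U -> definable_term vs V ->
  Delta0 Xs vs (fun g => candidate (T g) (U g) (V g)).
Proof. intros HS HT HU HV. unfold candidate. delta0. Qed.

#[local] Hint Resolve delta0_candidate : delta0.

Lemma delta0_greedy_below {Env} Xs (vs : list (Env -> num M)) T U :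
  In S Xs -> definable_term vs T -> definable_term vs U ->
  Delta0 Xs vs (fun g => greedy_below (T g) (U g)).
Proof. intros HS HT HU. unfold greedy_below, least_candidate. delta0. Qed.

#[local] Hint Resolve delta0_greedy_below : delta0.

Lemma least_candidate_unique c n t t' :
  least_candidate c n t -> least_candidate c n t' -> t = t'.
Proof.
  intros [C Mt] [C' Mt']. destruct (lt_trichotomy t t') as [L|[E|L]]; [|exact E|].
  - now apply Mt' in L.
  - now apply Mt in L.
Qed.

Lemma least_candidate_ext c c' n t :
  (forall q s, q < n -> dom q -> (maps c q s <-> maps c' q s)) ->
  least_candidate c n t <-> least_candidate c' n t.
Proof.
  intros E. assert (K : forall u, candidate c n u <-> candidate c' n u).
  { intros u. unfold candidate.
    split; intros (Hu & L & C); (split; [exact Hu|split; [exact L|]]);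
      intros q Lq Dq s Hs; apply C; try assumption; now apply E. }
  unfold least_candidate. rewrite K.
  split; intros [C N]; (split; [exact C|]); intros u Lu; [rewrite <- K|rewrite K]; auto.
Qed.

Lemma greedy_below_maps_iff n c q s :
  greedy_below n c -> q < n -> dom q -> (maps c q s <-> least_candidate c q s).
Proof.
  intros G L D. destruct (G q L D) as [[t Ht] C]. split; [apply C|].
  intros Hs. now rewrite (least_candidate_unique c q s t Hs (C t Ht)).
Qed.

Lemma greedy_below_unique n c c' : greedy_below n c -> greedy_below n c' ->
  forall q, q < n -> dom q -> forall s, maps c q s -> maps c' q s.
Proof.
  intros G G'. enough (K : forall q, q < n -> dom q ->
    (forall s, maps c q s -> maps c' q s) /\ (forall s, maps c' q s -> maps c q s)).
  { intros q L D. now apply K. }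
  intros q. delta0_strong_induct q. intros q IH L D.
  assert (E : forall s, maps c q s <-> maps c' q s).
  { intros s. rewrite (greedy_below_maps_iff n c), (greedy_below_maps_iff n c') by assumption.
    apply least_candidate_ext. intros r t Lr Dr.
    destruct (IH r Lr (lt_trans _ _ _ Lr L) Dr) as [K K']. split; auto. }
  split; intros s; apply E.
Qed.

Lemma greedy_below_succ n c : greedy_below n c -> exists c', greedy_below (n + 1) c'.
Proof.
  intros G. destruct (classic (dom n)) as [D|D].
  2: { exists c. intros q L Dq. apply lt_succ_r in L as [L| ->]; [auto|easy]. }
  least_such (candidate c n) as t Ct Mt.
  { apply extendable; [exact D|]. intros q s L Dq H. now apply (G q L Dq). }
  destruct (finite_map_extension n c t) as [c' C]. exists c'.
  assert (E : forall q s, q < n -> (maps c q s <-> maps c' q s)).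
  { intros q s L. rewrite C. split; [auto|]. intros [[_ H]|[-> _]]; [exact H|].
    now apply lt_irrefl in L. }
  intros q L Dq. apply lt_succ_r in L as [L| ->].
  - destruct (G q L Dq) as [[s Hs] H]. split; [exists s; now apply E|].
    intros u Hu. apply (least_candidate_ext c); [|apply H; now apply E].
    intros r v Lr _. exact (E r v (lt_trans _ _ _ Lr L)).
  - split; [exists t; apply C; now right|].
    intros u Hu. apply C in Hu as [[L _]|[_ ->]]; [now apply lt_irrefl in L|].
    apply (least_candidate_ext c); [|now split]. intros r v Lr _. now apply E.
Qed.

Lemma greedy_below_ex n : exists c, greedy_below n c.
Proof.
  sigma1_induct n.
  - exists 0. intros q L. now apply lt_0_r in L.
  - intros n [c G]. exact (greedy_below_succ n c G).
Qed.

Definition greedy_value (q s : num M) : Prop :=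
  dom q /\ exists c, greedy_below (q + 1) c /\ maps c q s.

Lemma greedy_value_iff n c q s :
  greedy_below n c -> q < n -> dom q -> (greedy_value q s <-> maps c q s).
Proof.
  intros G L D. assert (G' : greedy_below (q + 1) c).
  { intros r Lr. apply G. apply lt_succ_r in Lr as [Lr| ->]; [|exact L].
    exact (lt_trans _ _ _ Lr L). }
  split; [|intros H; split; [exact D|now exists c]].
  intros (_ & c' & G'' & H).
  now apply (greedy_below_unique (q + 1) c' c G'' G' q (le_refl q) D).
Qed.

Lemma greedy_value_ex q : dom q -> exists s, greedy_value q s.
Proof.
  intros D. destruct (greedy_below_ex (q + 1)) as [c G].
  destruct (G q (le_refl q) D) as [[s H] _]. exists s. split; [exact D|now exists c].
Qed.

Lemma greedy_value_unique q s s' : greedy_value q s -> greedy_value q s' -> s = s'.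
Proof.
  intros (D & c & G & H) H'. apply (greedy_value_iff _ _ _ _ G (le_refl q) D) in H'.
  destruct (G q (le_refl q) D) as [_ C]. now apply (least_candidate_unique c q); apply C.
Qed.

Lemma greedy_value_mem q s : greedy_value q s -> mem s S /\ q <= s.
Proof.
  intros (D & c & G & H). destruct (G q (le_refl q) D) as [_ C].
  destruct (C s H) as [(Hs & L & _) _]. now split.
Qed.

Lemma greedy_value_compat q s r t :
  q < r -> greedy_value q s -> greedy_value r t -> compat q s r t.
Proof.
  intros L H (D & c & G & H'). destruct (G r (le_refl r) D) as [_ C].
  destruct (C t H') as [(_ & _ & K) _]. assert (Dq : dom q) by apply H.
  apply K; [exact L|exact Dq|].
  apply (greedy_value_iff _ _ _ _ G) in H; [exact H| |exact Dq]. now apply lt_le_incl.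
Qed.

Lemma greedy_graph : exists H,
  (forall x, mem x H -> exists q s, PairR M q s x) /\
  forall q s, HRel M H q s <-> greedy_value q s.
Proof.
  destruct (delta1_comprehension ltac:(numbers) ltac:(sets)
    (fun x c => exists q, q <= x /\ exists s, s <= x /\
       (PairR M q s x /\ dom q /\ greedy_below (q + 1) c /\ maps c q s))
    (fun x c => exists q, q <= x /\ exists s, s <= x /\
       (PairR M q s x /\ dom q /\ (greedy_below (q + 1) c -> maps c q s)))) as [H HH];
    [delta0|delta0| |].
  - intros x. split.
    + intros (c & q & Lq & s & Ls & P & D & G & V) c'.
      exists q. split; [exact Lq|]. exists s. split; [exact Ls|].
      split; [exact P|split; [exact D|]]. intros G'.
      exact (greedy_below_unique (q + 1) c c' G G' q (le_refl q) D s V).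
    + intros K. destruct (K 0) as (q & Lq & s & Ls & P & D & _).
      destruct (greedy_below_ex (q + 1)) as [c G], (K c) as (q' & _ & s' & _ & P' & _ & V).
      destruct (PairR_inj _ _ _ _ _ P P') as [<- <-].
      exists c, q. split; [exact Lq|]. exists s. auto 7.
  - exists H. split.
    { intros x K. apply HH in K as (c & q & _ & s & _ & P & _). now exists q, s. }
    intros q s. split.
    + intros (x & P & K). apply HH in K as (c & q' & _ & s' & _ & P' & D & G & V).
      destruct (PairR_inj _ _ _ _ _ P P') as [<- <-]. split; [exact D|now exists c].
    + intros (D & c & G & V). destruct (PairR_ex q s) as [x P].
      exists x. split; [exact P|]. apply HH. exists c, q. split; [exact (PairR_le_l _ _ _ P)|].
      exists s. split; [exact (PairR_le_r _ _ _ P)|auto].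
Qed.

Theorem greedy_choice : exists H T : sset M,
  (forall x, mem x H -> exists q s, PairR M q s x /\ dom q /\ mem s T) /\
  (forall q, dom q -> exists s, HRel M H q s) /\
  (forall q s s', HRel M H q s -> HRel M H q s' -> s = s') /\
  (forall s, mem s T -> mem s S /\ exists q, dom q /\ HRel M H q s) /\
  (forall q s r t, q < r -> HRel M H q s -> HRel M H r t -> compat q s r t).
Proof.
  destruct greedy_graph as (H & HP & HV).
  comprehend (fun s => exists q, q <= s /\ HRel M H q s) as T HT.
  assert (TV : forall q s, greedy_value q s -> mem s T).
  { intros q s V. apply HT. exists q. split; [now apply (greedy_value_mem q s)|now apply HV]. }
  exists H, T. split; [|split; [|split; [|split]]].
  - intros x K. destruct (HP x K) as (q & s & P). exists q, s.
    assert (V : greedy_value q s) by (apply HV; now exists x).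
    split; [exact P|split; [apply V|exact (TV q s V)]].
  - intros q D. destruct (greedy_value_ex q D) as [s V]. exists s. now apply HV.
  - intros q s s' K K'. apply HV in K, K'. exact (greedy_value_unique q s s' K K').
  - intros s K. apply HT in K as (q & _ & K). apply HV in K as V.
    split; [now apply (greedy_value_mem q s)|]. exists q. split; [apply V|exact K].
  - intros q s r t L K K'. apply HV in K, K'. now apply greedy_value_compat.
Qed.

End GreedyChoice.

Definition order_compatible (q s r t : num M) : Prop :=
  (qlt M q r -> qlt M s t) /\ (qlt M r q -> qlt M t s).

Lemma delta0_order_compatible {Env} Xs (vs : list (Env -> num M)) T U V W :
  definable_term vs T -> definable_term vs U -> definable_term vs V -> definable_term vs W ->
  Delta0 Xs vs (fun g => order_compatible (T g) (U g) (V g) (W g)).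
Proof. intros. unfold order_compatible. delta0. Qed.

Lemma order_compatible_extendable (S : sset M) (n c : num M) : DLOwoEnd M S -> IsQ M n ->
  (forall q s, q < n -> IsQ M q -> maps c q s -> candidate (IsQ M) order_compatible S c q s) ->
  exists t, candidate (IsQ M) order_compatible S c n t.
Proof.
  intros HS Qn C.
  comprehend (fun s => s <= c /\ exists q, q < n /\ (IsQ M q /\ qlt M q n /\ maps c q s)) as L HL.
  comprehend (fun s => s <= c /\ exists q, q < n /\ (IsQ M q /\ qlt M n q /\ maps c q s)) as U HU.
  destruct (dense_cut_large S HS L U (c + 1) n) as (t & Ht & nt & Lt & Ut).
  - intros s K. apply HL in K as (Ls & q & Lq & Qq & _ & V). split; [|exact Ls].
    now apply (C q s).
  - intros s K. apply HU in K as (Ls & q & Lq & Qq & _ & V). split; [|exact Ls].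
    now apply (C q s).
  - intros s t K K'. apply HL in K as (_ & q & Lq & Qq & qn & V).
    apply HU in K' as (_ & r & Lr & Qr & nr & V').
    assert (qr : qlt M q r) by exact (qlt_trans _ _ _ qn nr).
    destruct (lt_trichotomy q r) as [G|[<-|G]]; [|now apply qlt_irrefl in qr|].
    + destruct (C r t Lr Qr V') as (_ & _ & K). now apply (K q G Qq s V).
    + destruct (C q s Lq Qq V) as (_ & _ & K). now apply (K r G Qr t V').
  - exists t. split; [exact Ht|split; [exact nt|]]. intros q Lq Qq s V.
    pose proof (maps_le _ _ _ V) as Ls. split; intros G.
    + apply Lt, HL. eauto 10.
    + apply Ut, HU. eauto 10.
Qed.

Lemma dense_contains_Q (S : sset M) :
  DLOwoEnd M S -> exists T, (forall x, mem x T -> mem x S) /\ OrderTypeQ M T.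
Proof.
  intros HS.
  destruct (greedy_choice (IsQ M) order_compatible S (@delta0_IsQ) (@delta0_order_compatible))
    as (H & T & HD & Total & Functional & Range & Order).
  { intros n c. now apply order_compatible_extendable. }
  exists T. split; [intros s K; now apply Range|]. split.
  { intros s K. apply HS. now apply Range. }
  exists H. split; [exact HD|split; [exact Total|split; [exact Functional|split]]].
  - intros s K. now apply Range.
  - intros q q' s s' K K' L. destruct (lt_trichotomy q q') as [G|[<-|G]].
    + now apply (Order q s q' s').
    + now apply qlt_irrefl in L.
    + now apply (Order q' s' q s).
Qed.

(** * From four colours to the Erdos-Rado theorem *)

Lemma lt_two (i : num M) : i < two M -> i = 0 \/ i = 1.
Proof.
  intros H. apply lt_succ_r in H as [H|H]; [left|now right].
  rewrite <- (add_0_l 1) in H. apply lt_succ_r in H as [H|H]; [now apply lt_0_r in H|exact H].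
Qed.

Lemma Col_lt (k : num M) (F : sset M) : IsColoring M k F ->
  forall p q i, Col M F p q i -> i < k.
Proof.
  intros [Range _] p q i (x & C & K). destruct (Range x K) as (p' & q' & i' & C' & _ & _ & L).
  now destruct (Code3_inj _ _ _ _ _ _ _ C C') as (_ & _ & ->).
Qed.

Lemma coloring_comprehension (k : num M) Xs (R : num M -> num M -> num M -> Prop) :
  (forall Env (vs : list (Env -> num M)) T U V,
    definable_term vs T -> definable_term vs U -> definable_term vs V ->
    Delta0 Xs vs (fun g => R (T g) (U g) (V g))) ->
  (forall p q i, R p q i -> i < k) ->
  (forall p q, IsQ M p -> IsQ M q -> qlt M p q -> exists i, R p q i) ->
  (forall p q i j, R p q i -> R p q j -> i = j) ->
  exists G, IsColoring M k G /\
    forall p q i, IsQ M p -> IsQ M q -> qlt M p q -> (Col M G p q i <-> R p q i).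
Proof.
  intros delta0_R Range Total Unique.
  destruct (delta0_comprehension [] Xs (fun x => exists p q i, Code3 M p q i x /\
    (IsQ M p /\ IsQ M q /\ qlt M p q /\ R p q i))) as [G HG].
  { apply (delta0_ex_Code3 _ _ _ (fun _ p q i => IsQ M p /\ IsQ M q /\ qlt M p q /\ R p q i));
      delta0. }
  assert (CG : forall p q i, Col M G p q i <-> IsQ M p /\ IsQ M q /\ qlt M p q /\ R p q i).
  { intros p q i. split.
    - intros (x & C & K). apply HG in K as (p' & q' & i' & C' & K).
      now destruct (Code3_inj _ _ _ _ _ _ _ C C') as (<- & <- & <-).
    - intros K. destruct (Code3_ex p q i) as [x C]. exists x. split; [exact C|].
      apply HG. now exists p, q, i. }
  exists G. split; [split; [|split]|].
  - intros x K. apply HG in K as (p & q & i & C & Qp & Qq & L & K).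
    exists p, q, i. repeat (split; [assumption|]). exact (Range p q i K).
  - intros p q Qp Qq L. destruct (Total p q Qp Qq L) as [i K]. exists i. now apply CG.
  - intros p q i j Ki Kj. apply CG in Ki, Kj. now apply (Unique p q).
  - intros p q i Qp Qq L. rewrite CG. tauto.
Qed.

(* The product of [F] with Sierpinski's colouring, which tells whether the order of two
   rationals agrees with the order of their codes. *)
Definition sierpinski_color (F : sset M) (p q j : num M) : Prop :=
  exists i, i <= j /\ (Col M F p q i /\ ((p < q /\ j = i + two M) \/ (~ p < q /\ j = i))).

Lemma sierpinski_color_agree F p q i :
  Col M F p q i -> p < q -> sierpinski_color F p q (i + two M).
Proof. intros C L. exists i. split; [apply le_add_r|auto]. Qed.

Lemma sierpinski_color_disagree F p q i :
  Col M F p q i -> ~ p < q -> sierpinski_color F p q i.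
Proof. intros C L. exists i. split; [apply le_refl|auto]. Qed.

Lemma sierpinski_color_lt F p q j :
  IsColoring M (two M) F -> sierpinski_color F p q j -> j < four M.
Proof.
  intros HF (i & _ & C & D). apply (Col_lt _ _ HF) in C. destruct D as [[_ ->]|[_ ->]].
  - now apply add_lt_mono_r.
  - apply (lt_le_trans _ (two M)); [exact C|apply le_add_r].
Qed.

Lemma sierpinski_color_unique F p q j j' : IsColoring M (two M) F ->
  sierpinski_color F p q j -> sierpinski_color F p q j' -> j = j'.
Proof.
  intros (_ & _ & Unique) (i & _ & C & D) (i' & _ & C' & D').
  rewrite (Unique p q i' i C' C) in D'.
  destruct D as [[L ->]|[L ->]], D' as [[L' ->]|[L' ->]]; easy.
Qed.

Lemma sierpinski_coloring (F : sset M) : IsColoring M (two M) F ->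
  exists G, IsColoring M (four M) G /\
    forall p q j, IsQ M p -> IsQ M q -> qlt M p q -> (Col M G p q j <-> sierpinski_color F p q j).
Proof.
  intros HF. apply (coloring_comprehension _ [F]).
  - intros Env vs T U V HT HU HV. unfold sierpinski_color, two. delta0.
  - intros p q j. now apply sierpinski_color_lt.
  - intros p q Qp Qq L. destruct HF as (_ & Total & _), (Total p q Qp Qq L) as [i C].
    destruct (classic (p < q)) as [Lpq|Lpq]; eexists.
    + now apply sierpinski_color_agree with (i := i).
    + now apply sierpinski_color_disagree with (i := i).
  - intros p q i j. now apply sierpinski_color_unique.
Qed.

Lemma one_neq_add_two (i : num M) : 1 <> i + two M.
Proof.
  intros E. apply (neq_add_succ 1 i). rewrite E at 1. unfold two. ring.
Qed.

Lemma color_one_of_sierpinski (F : sset M) p q j : IsColoring M (two M) F ->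
  sierpinski_color F p q j -> j = 1 + two M \/ j = 1 -> Col M F p q 1.
Proof.
  intros HF (i & _ & C & D) E.
  destruct D as [[_ ->]|[_ ->]], E as [E|E].
  - apply add_cancel_r in E. now subst i.
  - now destruct (one_neq_add_two i).
  - apply (Col_lt _ _ HF) in C. rewrite E in C.
    destruct (le_not_lt (two M) (1 + two M) (le_add_l _ _) C).
  - now subst i.
Qed.

Lemma color_zero_or_one_occurs (F S : sset M) (P : num M -> num M -> Prop) :
  IsColoring M (two M) F ->
  (forall p q i, mem p S -> mem q S -> qlt M p q -> P p q -> Col M F p q i -> i = 0) \/
  exists p q, mem p S /\ mem q S /\ qlt M p q /\ P p q /\ Col M F p q 1.
Proof.
  intros HF.
  destruct (classic (exists p q, mem p S /\ mem q S /\ qlt M p q /\ P p q /\ Col M F p q 1))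
    as [K|N]; [now right|left].
  intros p q i Hp Hq L Ppq C. destruct (lt_two i (Col_lt _ _ HF _ _ _ C)) as [E| ->]; [exact E|].
  destruct N. now exists p, q.
Qed.

Lemma two_sierpinski_colors (F S : sset M) (c d : num M) : IsColoring M (two M) F ->
  (forall p q j, mem p S -> mem q S -> qlt M p q -> sierpinski_color F p q j -> j = c \/ j = d) ->
  (forall p q i, mem p S -> mem q S -> qlt M p q -> p < q -> Col M F p q i -> i = 0) \/
  (forall p q i, mem p S -> mem q S -> qlt M p q -> ~ p < q -> Col M F p q i -> i = 0) \/
  (forall p q i, mem p S -> mem q S -> qlt M p q -> Col M F p q i -> i = 1).
Proof.
  intros HF Hcd.
  destruct (color_zero_or_one_occurs F S lt HF) as [K|(p & q & Hp & Hq & L & A & C)]; [now left|].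
  destruct (color_zero_or_one_occurs F S (fun p q => ~ p < q) HF)
    as [K|(p' & q' & Hp' & Hq' & L' & D & C')]; [now right; left|].
  right; right. intros r s i Hr Hs Lrs Crs.
  apply (proj2 (proj2 HF) r s); [exact Crs|].
  assert (J : exists j, sierpinski_color F r s j).
  { destruct (classic (r < s)) as [Ars|Drs]; eexists.
    - exact (sierpinski_color_agree _ _ _ _ Crs Ars).
    - exact (sierpinski_color_disagree _ _ _ _ Crs Drs). }
  destruct J as [j J]. apply (color_one_of_sierpinski F r s j HF J).
  pose proof (Hcd _ _ _ Hp Hq L (sierpinski_color_agree _ _ _ _ C A)) as K.
  pose proof (Hcd _ _ _ Hp' Hq' L' (sierpinski_color_disagree _ _ _ _ C' D)) as K'.
  pose proof (Hcd _ _ _ Hr Hs Lrs J) as Kj.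
  assert (N : 1 + two M <> 1) by (intros E; now apply (one_neq_add_two 1)).
  destruct K, K', Kj; subst; auto; congruence.
Qed.

Lemma dense_agreeing_subset (S : sset M) : DLOwoEnd M S -> exists X,
  (forall x, mem x X -> mem x S) /\ Infinite M X /\
  forall p q, mem p X -> mem q X -> (p < q <-> qlt M p q).
Proof.
  intros HS. apply infinite_ascending_subset; try apply HS.
  - exact (@delta0_qlt).
  - exact qlt_irrefl.
  - exact qlt_trans.
  - now apply dense_qlt_total.
  - now apply dense_no_maximum.
Qed.

Lemma dense_disagreeing_subset (S : sset M) : DLOwoEnd M S -> exists X,
  (forall x, mem x X -> mem x S) /\ Infinite M X /\
  forall p q, mem p X -> mem q X -> (p < q <-> qlt M q p).
Proof.
  intros HS. apply (infinite_ascending_subset (fun p q => qlt M q p)); try apply HS.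
  - exact (@delta0_qgt).
  - exact qlt_irrefl.
  - exact qgt_trans.
  - now apply dense_qgt_total.
  - now apply dense_no_minimum.
Qed.

End Model.

Theorem theorem5p44 : forall M : L2, RCA0 M -> DT2_4_2 M -> ER2 M.
Proof.
  intros M M_RCA0 DT F HF.
  destruct (sierpinski_coloring M M_RCA0 F F HF) as (G & HG & CG).
  destruct (DT G HG) as (S & HS & c & d & Hcd).
  destruct (two_sierpinski_colors M M_RCA0 F F S c d HF) as [Zero|[Zero|One]].
  - intros p q j Hp Hq L J. apply (Hcd p q); try apply CG; auto; now apply HS.
  - destruct (dense_agreeing_subset M M_RCA0 F S HS) as (X & XS & Inf & Agree).
    exists X. split; [intros x Hx; now apply HS, XS|left; split; [exact Inf|]].
    intros p q i Hp Hq L. apply Zero; auto. now apply Agree.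
  - destruct (dense_disagreeing_subset M M_RCA0 F S HS) as (X & XS & Inf & Disagree).
    exists X. split; [intros x Hx; now apply HS, XS|left; split; [exact Inf|]].
    intros p q i Hp Hq L. apply Zero; auto. intros A.
    apply Disagree in A; auto. now apply (qlt_asym M M_RCA0 F p q).
  - destruct (dense_contains_Q M M_RCA0 F S HS) as (T & TS & OT).
    exists T. split; [apply OT|right; split; [exact OT|]].
    intros p q i Hp Hq. apply One; auto.
Qed.
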